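(* Let $(\pi,M)$ be the mesh pattern $(132,\{(2,0)\})$. For all $n\ge 1$, $$\sum_{\sigma \in \mathrm{Av}_n((\pi,M))} q^{\mathrm{des}(\sigma)} = \sum_{k=0}^{n-1} S(n,k+1)\,q^k,$$ where $S(n,k)$ denotes the Stirling number of the second kind, the number of partitions of $[n]$ into $k$ nonempty blocks.
   Context: $\mathfrak{S}_n$ is the set of permutations of $[n]=\{1,\dots,n\}$, written in one-line notation $\sigma = a_1\dots a_n$ with $a_i=\sigma(i)$. The descent statistic is $\mathrm{des}(\sigma) = |\{i \in [n-1] : a_i > a_{i+1}\}|$. A mesh pattern is a pair $(\pi,M)$ with $\pi \in \mathfrak{S}_k$ and $M \subseteq \{0,1,\dots,k\}^2$. The element $(x,y)\in M$ represents the shaded unit box with bottom-left corner $(x,y)$ in the plot of $\pi$. A permutation $\sigma \in \mathfrak{S}_n$ contains $(\pi,M)$ if there are positions $1 \le i_1 < \dots < i_k \le n$ such that $a_{i_1}\dots a_{i_k}$ is in the same relative order as $\pi$ and, writing $v_1<\dots<v_k$ for the values $a_{i_1},\dots,a_{i_k}$ in increasing order and setting $i_0=v_0=0$, $i_{k+1}=v_{k+1}=n+1$, for every $(x,y)\in M$ there is no $m$ with $i_x<m<i_{x+1}$ and $v_y<a_m<v_{y+1}$. Otherwise $\sigma$ avoids $(\pi,M)$. $\mathrm{Av}_n((\pi,M))$ is the set of $\sigma\in\mathfrak{S}_n$ avoiding $(\pi,M)$. *)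

(* Defs.v *)
From mathcomp Require Import all_boot all_order all_fingroup all_algebra.

Set Implicit Arguments.
Unset Strict Implicit.
Unset Printing Implicit Defensive.

Import GRing.Theory.

(* Permutations of [n] are elements of 'S_n acting on 'I_n = {0, ..., n-1};
   the position i and the value s i stand for i.+1 and (s i).+1. *)

Definition one_line n (s : 'S_n) : seq nat := [seq (s i).+1 | i <- enum 'I_n].

Definition des n (s : 'S_n) : nat :=
  #|[set i : 'I_n.-1 | nth 0 (one_line s) i.+1 < nth 0 (one_line s) i]|.

Definition mesh_pattern k : Type := ('S_k * {set 'I_k.+1 * 'I_k.+1})%type.

(* The sequences 0 = i_0, i_1, ..., i_k, i_{k+1} = n+1 and
   0 = v_0, v_1 < ... < v_k, v_{k+1} = n+1 attached to a choice c of k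
   positions. *)

Definition mesh_cols k n (c : {ffun 'I_k -> 'I_n}) : seq nat :=
  0 :: rcons [seq (c j).+1 | j <- enum 'I_k] n.+1.

Definition mesh_rows k n (s : 'S_n) (c : {ffun 'I_k -> 'I_n}) : seq nat :=
  0 :: rcons (sort leq [seq (s (c j)).+1 | j <- enum 'I_k]) n.+1.

Definition box_empty k n (s : 'S_n) (c : {ffun 'I_k -> 'I_n}) (x y : nat) :
    bool :=
  [forall m : 'I_n,
     ~~ [&& nth 0 (mesh_cols c) x < m.+1,
            m.+1 < nth 0 (mesh_cols c) x.+1,
            nth 0 (mesh_rows s c) y < (s m).+1
          & (s m).+1 < nth 0 (mesh_rows s c) y.+1]].

Definition mesh_occurrence k (p : mesh_pattern k) n (s : 'S_n)
    (c : {ffun 'I_k -> 'I_n}) : bool :=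
  [&& [forall i : 'I_k, forall j : 'I_k, (i < j) ==> (c i < c j)],
      [forall i : 'I_k, forall j : 'I_k,
         (s (c i) < s (c j)) == (p.1 i < p.1 j)]
    & [forall b in p.2, box_empty s c b.1 b.2]].

Definition contains k (p : mesh_pattern k) n (s : 'S_n) : bool :=
  [exists c : {ffun 'I_k -> 'I_n}, mesh_occurrence p s c].

Definition Av n k (p : mesh_pattern k) : {set 'S_n} :=
  [set s : 'S_n | ~~ contains p s].

Definition perm132 : 'S_3 := tperm (inord 1) (inord 2).

Lemma one_line_perm132 : one_line perm132 = [:: 1; 3; 2].
Proof.
rewrite /one_line /perm132 enum_ordSl /= enum_ordSl /= enum_ordSl /=.
rewrite (_ : enum 'I_0 = [::]); last by apply: size0nil; rewrite size_enum_ord.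
by rewrite /= !permE /= -!(inj_eq val_inj) /= !inordK.
Qed.

Definition mesh132_20 : mesh_pattern 3 := (perm132, [set (inord 2, inord 0)]).

Definition stirling2 (n k : nat) : nat :=
  #|[set P : {set {set 'I_n}} | partition P [set: 'I_n] & #|P| == k]|.

(* Main.v *)
(** A permutation avoids (132, {(2,0)}) iff every descent bottom is a
    left-to-right minimum.  So its ascending runs start at the left-to-right
    minima, each run starts with its least value, and these least values
    decrease: such permutations correspond to set partitions, the blocks being
    written increasingly and in decreasing order of their minima.  The number
    of descents is one less than the number of blocks. *)

Require Import Defs.
From mathcomp Require Import all_boot all_order all_fingroup all_algebra.
From mathcomp Require Import zify.

Set Implicit Arguments.
Unset Strict Implicit.
Unset Printing Implicit Defensive.

Import GRing.Theory.

(** * Induction, counting and enumeration on ordinals *)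

Lemma ord_interval_ind n (P : 'I_n -> Prop) (j k : 'I_n) :
  j <= k -> P j ->
  (forall t u : 'I_n, j <= t -> u = t.+1 :> nat -> u <= k -> P t -> P u) ->
  P k.
Proof.
move=> le_jk Pj step.
have [d] : {d | k = j + d :> nat} by exists (k - j); lia.
elim: d k le_jk step => [|d IH] k le_jk step def_k.
  by rewrite (_ : k = j) //; apply: val_inj; rewrite /= def_k addn0.
have lt_t : j + d < n by have := ltn_ord k; lia.
apply: (step (Ordinal lt_t)) => //=; try lia.
apply: IH => //=; try lia.
by move=> t u le_jt def_u le_u; apply: step => //; rewrite def_k; lia.
Qed.

Lemma card_ord_lt n (p : 'I_n) : #|[set q : 'I_n | q < p]| = p.
Proof.
have le_pn := ltnW (ltn_ord p).
rewrite -[RHS]card_ord -cardsT.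
have widen_inj : injective (widen_ord le_pn).
  by move=> i j /(congr1 val) /= eq_ij; apply: val_inj.
rewrite -(card_imset _ widen_inj).
apply: eq_card => q; rewrite inE; apply/idP/imsetP => [lt_qp | [i _ ->]] /=.
  by exists (Ordinal lt_qp) => //; apply: val_inj.
exact: ltn_ord.
Qed.

Lemma all_ord3 (P : pred 'I_3) :
  [forall i, P i] = [&& P (inord 0), P (inord 1) & P (inord 2)].
Proof.
apply/forallP/and3P => [H | [P0 P1 P2] i]; first by split.
have [|[|]] : i = inord 0 \/ i = inord 1 \/ i = inord 2; try by move->.
case: i => [[|[|[|//]]] lt_i]; [left | right; left | right; right].
all: by apply: val_inj; rewrite /= inordK.
Qed.

(** * Occurrences and avoidance of the mesh pattern *)

Lemma perm132E :
  (perm132 (inord 0) = inord 0) * (perm132 (inord 1) = inord 2) *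
  (perm132 (inord 2) = inord 1).
Proof.
by rewrite /perm132 tpermL tpermR tpermD // -(inj_eq val_inj) /= !inordK.
Qed.

Lemma map_enum_ord3 (T : Type) (f : 'I_3 -> T) :
  [seq f i | i <- enum 'I_3] = [:: f (inord 0); f (inord 1); f (inord 2)].
Proof.
rewrite (_ : enum 'I_3 = [:: inord 0; inord 1; inord 2]) //.
by apply: (inj_map val_inj); rewrite val_enum_ord /= !inordK.
Qed.

(** The shaded box spans the columns strictly between [j] and [k] and the rows below the least value
    [s i]; its lower row bound 0 constrains nothing. *)
Lemma mesh_occurrence132E n (s : 'S_n) (c : {ffun 'I_3 -> 'I_n})
    (i := c (inord 0)) (j := c (inord 1)) (k := c (inord 2)) :
  mesh_occurrence mesh132_20 s c =
  [&& i < j < k, s i < s k < s j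
    & [forall m : 'I_n, (j < m < k) ==> (s i <= s m)]].
Proof.
have inordE (m : nat) : m < 3 -> (inord m : 'I_3) = m :> nat by exact: inordK.
rewrite /mesh_occurrence !all_ord3 /= !perm132E !inordE // -/i -/j -/k.
rewrite !ltnn !eqxx /=.
have -> : [forall b in [set (inord 2 : 'I_4, inord 0 : 'I_4)],
    box_empty s c b.1 b.2] = box_empty s c 2 0.
  apply/forall_inP/idP => [/(_ _ (set11 _)) | H b /set1P->].
    by rewrite /= !inordK.
  by rewrite /= !inordK.
case: (boolP (i < j < k)) => [/andP[lt_ij lt_jk]|]; last first.
  by move=> H /=; apply/negbTE; lia.
case: (boolP (s i < s k < s j)) => [/andP[lt_ik lt_kj]|]; last first.
  by move=> H /=; apply/negbTE; lia.
rewrite (_ : [&& _, _ & _] = box_empty s c 2 0); last by lia.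
rewrite /box_empty /mesh_cols /mesh_rows !map_enum_ord3 -/i -/j -/k.
have -> : sort leq [:: (s i).+1; (s j).+1; (s k).+1] =
          [:: (s i).+1; (s k).+1; (s j).+1].
  apply: (sorted_eq leq_trans anti_leq); first exact/sort_sorted/leq_total.
    by rewrite /=; lia.
  by rewrite perm_sort /= perm_cons (perm_catC [:: _] [:: _]).
apply: eq_forallb => m /=; lia.
Qed.

(* The mesh pattern is avoided iff the vincular pattern 1-32 is: in an
   occurrence with empty box, the descent from j to k is witnessed by two
   adjacent positions whose values stay above that of i. *)
Lemma Av132P n (s : 'S_n) :
  reflect (forall i t u : 'I_n, i <= t -> u = t.+1 :> nat -> s u < s t ->
             s u < s i)
          (s \in Av n mesh132_20).
Proof.
rewrite inE; apply: (iffP idP) => [avs i t u le_it def_u lt_ut | vinc].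
  have [//|le_iu] := ltnP (s u) (s i).
  have neq_it : i != t by apply/eqP => eq_it; move: le_iu; rewrite eq_it; lia.
  have neq_iu : s i != s u by rewrite (inj_eq perm_inj) -(inj_eq val_inj) /=; lia.
  (* As [t] and [u] are adjacent, no position lies strictly between them, so the box of [i], [t],
     [u] is empty. *)
  case/existsP: avs; exists [ffun a : 'I_3 => nth i [:: i; t; u] a].
  rewrite mesh_occurrence132E !ffunE !inordK //=.
  move: neq_it neq_iu; rewrite -!(inj_eq val_inj) /= => neq_it neq_iu.
  apply/and3P; split; [lia | lia |].
  by apply/forallP => m; apply/implyP; lia.
apply/existsP => -[c]; rewrite mesh_occurrence132E.
set i := c _; set j := c _; set k := c _.
case/and3P => /andP[lt_ij lt_jk] /andP[lt_ik lt_kj] /forallP box.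
(* Going from [j] to [k], values stay at least [s j]: a drop at [u] gives [s u < s i < s k], so [u]
   is not [k] and its point lies in the empty box. *)
suff: s j <= s k by lia.
apply: (@ord_interval_ind _ (fun m => s j <= s m) j k) => // [|t u le_jt def_u le_uk le_jt'].
  exact: ltnW.
have [lt_ut|] := ltnP (s u) (s t); last by apply: leq_trans.
have lt_ui : s u < s i by apply: (vinc i t u) => //; lia.
have neq_uk : u != k by apply/eqP => eq_uk; move: lt_ui; rewrite eq_uk; lia.
move: neq_uk; rewrite -(inj_eq val_inj) /= => neq_uk.
by have /implyP := box u; lia.
Qed.

(** * Left-to-right minima *)

(** The prefix minimum at the position of the value [x]. It maps values to values, so that its
    fibres form a set partition with the minima as representatives. *)
Definition lr_min n (s : 'S_n) (x : 'I_n) : 'I_n :=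
  [arg min_(y < x | (s^-1)%g y <= (s^-1)%g x) y].

Lemma lr_min_pos n (s : 'S_n) x : (s^-1)%g (lr_min s x) <= (s^-1)%g x.
Proof. by rewrite /lr_min; case: arg_minnP. Qed.

Lemma lr_min_min n (s : 'S_n) x y :
  (s^-1)%g y <= (s^-1)%g x -> lr_min s x <= y.
Proof. by rewrite /lr_min; case: arg_minnP => // z _; apply. Qed.

Lemma lr_min_le n (s : 'S_n) x : lr_min s x <= x.
Proof. exact: lr_min_min. Qed.

Lemma lr_min_anti n (s : 'S_n) x y :
  (s^-1)%g x <= (s^-1)%g y -> lr_min s y <= lr_min s x.
Proof. by move=> le_xy; apply/lr_min_min/(leq_trans _ le_xy)/lr_min_pos. Qed.

Lemma lr_min_id n (s : 'S_n) x : lr_min s (lr_min s x) = lr_min s x.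
Proof.
apply/val_inj/anti_leq; rewrite lr_min_le /=.
by apply/lr_min_anti/lr_min_pos.
Qed.

Lemma lr_min_unique n (s : 'S_n) x y :
  (s^-1)%g y <= (s^-1)%g x ->
  (forall z, (s^-1)%g z <= (s^-1)%g x -> y <= z) -> lr_min s x = y.
Proof.
move=> le_yx min_y; apply/val_inj/anti_leq.
by rewrite /= lr_min_min //= min_y // lr_min_pos.
Qed.

(** * Permutations sorted by blocks *)

(* The order in which values are written: blocks by decreasing minimum [r],
   increasingly within each block. *)
Definition block_lt n (r : 'I_n -> 'I_n) (x y : 'I_n) : bool :=
  (r y < r x) || (r x == r y) && (x < y).

Lemma block_lt_irr n (r : 'I_n -> 'I_n) x : block_lt r x x = false.
Proof. by rewrite /block_lt !ltnn andbF. Qed.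

Lemma block_lt_trans n (r : 'I_n -> 'I_n) : transitive (block_lt r).
Proof. by move=> y x z; rewrite /block_lt -!(inj_eq val_inj) /=; lia. Qed.

Lemma block_lt_total n (r : 'I_n -> 'I_n) x y :
  x != y -> block_lt r x y || block_lt r y x.
Proof. by rewrite /block_lt -!(inj_eq val_inj) /=; lia. Qed.

Definition sorts n (s : 'S_n) (r : 'I_n -> 'I_n) : Prop :=
  forall p q : 'I_n, (p < q) = block_lt r (s p) (s q).

(** A position is the number of positions before it, and [s] carries these to the predecessors of
    [x]; hence the order determines the permutation. *)
Lemma sorts_pos n (s : 'S_n) r x :
  sorts s r -> (s^-1)%g x = #|[set y | block_lt r y x]| :> nat.
Proof.
move=> srt; rewrite -[LHS]card_ord_lt -(card_imset _ (@perm_inj _ s)).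
apply: eq_card => y; rewrite [RHS]inE; apply/imsetP/idP => [[q]|lt_yx].
  by rewrite inE srt permKV => ? ->.
by exists ((s^-1)%g y); rewrite ?inE ?srt ?permKV.
Qed.

Lemma sorts_inj n (s t : 'S_n) r : sorts s r -> sorts t r -> s = t.
Proof.
move=> srt_s srt_t; apply: invg_inj; apply/permP => x.
by apply: val_inj; rewrite /= (sorts_pos _ srt_s) (sorts_pos _ srt_t).
Qed.

Lemma sorts_exist n (r : 'I_n -> 'I_n) : exists s : 'S_n, sorts s r.
Proof.
pose B x := [set y | block_lt r y x].
have ltB x y : block_lt r x y -> #|B x| < #|B y|.
  move=> lt_xy; apply/proper_card/properP; split.
    by apply/subsetP => z; rewrite !inE => /block_lt_trans; apply.
  by exists x; rewrite inE ?lt_xy ?block_lt_irr.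
have card_lt x : #|B x| < n.
  rewrite -[X in _ < X]card_ord -cardsT; apply/proper_card/properP.
  by split; [exact: subsetT | exists x; rewrite ?inE ?block_lt_irr].
pose f x := Ordinal (card_lt x).
have f_inj : injective f.
  move=> x y /(congr1 val) /= eqB; apply/eqP; case: (boolP (x == y)) => // neq_xy.
  by case/orP: (block_lt_total r neq_xy) => /ltB; rewrite eqB ltnn.
(* [f] sends a value to its rank, which is to be its position; a permutation sends positions to
   values, hence the inverse. *)
exists (perm f_inj)^-1%g => p q; set x := (perm f_inj)^-1%g p; set y := (perm f_inj)^-1%g q.
have -> : p = f x by rewrite -[LHS](permKV (perm f_inj)) permE.
have -> : q = f y by rewrite -[LHS](permKV (perm f_inj)) permE.
apply/idP/idP => [lt_xy|/ltB //].
have neq_xy : x != y by apply/eqP => eq_xy; rewrite eq_xy ltnn in lt_xy.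
by case/orP: (block_lt_total r neq_xy) => // /ltB; rewrite ltnNge ltnW.
Qed.

(** * Avoiders are exactly the permutations sorted by block minima *)

(** Prefix minima weakly decrease along positions, and where they stay constant no descent can
    occur, since its bottom would be a new minimum. *)
Lemma Av132_sorts n (s : 'S_n) : s \in Av n mesh132_20 -> sorts s (lr_min s).
Proof.
move/Av132P => avs.
have lt_block (p q : 'I_n) : p < q -> block_lt (lr_min s) (s p) (s q).
  move=> lt_pq.
  have : lr_min s (s q) <= lr_min s (s p) by apply: lr_min_anti; rewrite !permK ltnW.
  rewrite /block_lt leq_eqVlt => /orP[/eqP/val_inj eq_r | -> //].
  rewrite eq_r ltnn eqxx /= ltn_neqAle (inj_eq val_inj) (inj_eq perm_inj).
  have -> /= : p != q by rewrite -(inj_eq val_inj) ltn_eqF.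
  apply: (@ord_interval_ind _ (fun m => s p <= s m) p q) => //; first exact: ltnW.
  move=> t u le_pt def_u le_uq le_t; apply: (leq_trans le_t).
  rewrite leqNgt; apply/negP => lt_ut.
  have u_min : lr_min s (s u) = s u.
    apply: lr_min_unique => // z; rewrite permK leq_eqVlt => /orP[/eqP/val_inj <-|].
      by rewrite permKV.
    rewrite def_u ltnS => le_zt.
    by have := avs _ t u le_zt def_u lt_ut; rewrite permKV => /ltnW.
  have : lr_min s (s q) <= s u by apply: lr_min_min; rewrite !permK.
  have := lr_min_le s (s q).
  (* Avoidance applied at the position of the minimum for [p] puts [s u] strictly below it, although
     [u] is at or before [q], whose prefix minimum is the same. *)
  have : s u < lr_min s (s p).
    have := avs ((s^-1)%g (lr_min s (s p))) t u; rewrite permKV; apply => //.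
    by apply: leq_trans le_pt; have := lr_min_pos s (s p); rewrite permK.
  have : lr_min s (s q) <= lr_min s (s u) by apply: lr_min_anti; rewrite !permK.
  by rewrite eq_r u_min; lia.
move=> p q; apply/idP/idP => [/lt_block // | lt_b].
rewrite ltnNge leq_eqVlt; apply/negP => /orP[/eqP/val_inj eq_pq|/lt_block].
  by rewrite eq_pq block_lt_irr in lt_b.
by move/(block_lt_trans lt_b); rewrite block_lt_irr.
Qed.

Section SortedBlocks.

Variables (n : nat) (s : 'S_n) (r : 'I_n -> 'I_n).
Hypotheses (r_le : forall x, r x <= x) (r_id : forall x, r (r x) = r x).
Hypothesis srt : sorts s r.

Lemma sorts_anti x y : (s^-1)%g x <= (s^-1)%g y -> r y <= r x.
Proof.
rewrite leq_eqVlt => /orP[/eqP/val_inj/perm_inj-> // |].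
by rewrite srt !permKV /block_lt -(inj_eq val_inj) /=; lia.
Qed.

Lemma sorts_rep_pos x : (s^-1)%g (r x) <= (s^-1)%g x.
Proof.
rewrite leqNgt srt !permKV /block_lt r_id ltnn eqxx /= -leqNgt.
exact: r_le.
Qed.

(** A representative comes first in its block, and any value [z] written no later than [x] satisfies
    [r x <= r z <= z]. *)
Lemma sorts_lr_min : lr_min s =1 r.
Proof.
move=> x; apply: lr_min_unique (sorts_rep_pos x) _ => z /sorts_anti le_r.
exact: leq_trans (r_le z).
Qed.

(** Blocks are written increasingly, so a descent bottom opens a new block; it is then that block's
    representative, below all earlier representatives. *)
Lemma sorts_Av132 : s \in Av n mesh132_20.
Proof.
apply/Av132P => i t u le_it def_u lt_ut.
have le_r : r (s t) <= r (s i) by apply: sorts_anti; rewrite !permK.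
have lt_r : r (s u) < r (s t).
  have : t < u by rewrite def_u.
  rewrite srt /block_lt; lia.
(* Were the representative of [s u] before [u], it would be at or before [t], forcing
   [r (s t) <= r (s u)]. *)
have u_rep : r (s u) = s u.
  apply: (@perm_inj _ (s^-1)%g); apply/val_inj/anti_leq; rewrite /= sorts_rep_pos permK.
  rewrite leqNgt def_u ltnS; apply/negP => le_t.
  have := @sorts_anti (r (s u)) (s t); rewrite r_id permK => /(_ le_t).
  by lia.
by have := r_le (s i); rewrite -u_rep; lia.
Qed.

End SortedBlocks.

(** * Descents and left-to-right minima *)

(** The left-to-right minima of an avoider are its descent bottoms together with its first entry,
    which accounts for the successor. *)
Lemma card_fix_lr_min n (s : 'S_n.+1) : s \in Av n.+1 mesh132_20 ->
  #|[set x | lr_min s x == x]| = (des s).+1.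
Proof.
move/Av132P => avs.
have nth_s (i : 'I_n.+1) : nth 0 (one_line s) i = (s i).+1.
  by rewrite /one_line (nth_map i) ?size_enum_ord // nth_ord_enum.
pose up (i : 'I_n) : 'I_n.+1 := lift ord0 i.
have upE (i : 'I_n) : up i = i.+1 :> nat by [].
pose dn (i : 'I_n) : 'I_n.+1 := widen_ord (leqnSn n) i.
pose D := [set i : 'I_n | s (up i) < s (dn i)].
have -> : des s = #|D|.
  apply: eq_card => i; rewrite !inE.
  by rewrite -(upE i) (nth_s (up i)) (nth_s (dn i)) ltnS.
have inj_sup : injective (fun i => s (up i)).
  by move=> i j /perm_inj /lift_inj.
rewrite -(card_imset _ inj_sup).
have -> : [set x | lr_min s x == x] =
          s ord0 |: [set s (up i) | i in D].
  apply/setP => x; rewrite !inE -[x](permKV s); set p := (s^-1)%g x.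
  rewrite (inj_eq perm_inj).
  case: (unliftP ord0 p) => [i ->|->]; last first.
    rewrite eqxx /=; apply/eqP/lr_min_unique => // z; rewrite permK leqn0.
    by rewrite -[0]/(val (@ord0 n)) => /eqP/val_inj <-; rewrite permKV.
  rewrite -/(up i) (_ : (up i == ord0) = false) //= (mem_imset _ _ inj_sup) inE.
  apply/eqP/idP => [fix_i | lt_i].
    have : lr_min s (s (up i)) <= s (dn i) by apply: lr_min_min; rewrite !permK upE.
    rewrite fix_i leq_eqVlt => /orP[/eqP/val_inj/perm_inj/(congr1 val)|//].
    by rewrite /= /bump /=; lia.
  apply: lr_min_unique => // z; rewrite permK upE leq_eqVlt => /orP[].
    by rewrite -upE => /eqP/val_inj <-; rewrite permKV.
  rewrite ltnS => le_zi.
  by have := avs _ (dn i) (up i) le_zi erefl lt_i; rewrite permKV => /ltnW.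
rewrite cardsU1 (_ : s ord0 \notin _) //; apply/imsetP => -[i _ /perm_inj].
by move/(congr1 val).
Qed.

(** * The bijection with set partitions *)

Definition run_partition n (s : 'S_n) : {set {set 'I_n}} :=
  preim_partition (lr_min s) [set: 'I_n].

(** [lr_min s] is idempotent, so each of its fibres contains exactly one fixed point. *)
Lemma card_run_partition n (s : 'S_n) :
  #|run_partition s| = #|[set x | lr_min s x == x]|.
Proof.
pose block x := [set y in [set: 'I_n] | lr_min s x == lr_min s y].
rewrite -(@card_in_imset _ _ block) => [|x y]; last first.
  rewrite !inE => /eqP fix_x /eqP fix_y /setP/(_ y).
  by rewrite !inE eqxx fix_x fix_y => /eqP.
congr #|pred_of_set _|; apply/setP => B; apply/imsetP/imsetP => -[x fix_x ->].
  by exists (lr_min s x); rewrite ?inE ?lr_min_id // /block lr_min_id.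
by exists x.
Qed.

Lemma preim_partition_inj n (f g : 'I_n -> 'I_n) x y :
  preim_partition f [set: 'I_n] = preim_partition g [set: 'I_n] ->
  (f x == f y) = (g x == g y).
Proof.
move=> eq_fg; have eqv (h : 'I_n -> 'I_n) :
    {in [set: 'I_n] & &, equivalence_rel (fun x y => h x == h y)}.
  by split=> // /eqP->.
rewrite -(pblock_equivalence_partition (eqv f) (in_setT x) (in_setT y)).
rewrite -(pblock_equivalence_partition (eqv g) (in_setT x) (in_setT y)).
by rewrite -/(preim_partition f _) eq_fg.
Qed.

Lemma eq_sorts n (s : 'S_n) r r' : r =1 r' -> sorts s r -> sorts s r'.
Proof. by move=> eq_r srt p q; rewrite srt /block_lt !eq_r. Qed.

(** The partition determines [lr_min], which sends a value to the minimum of its block, and [lr_min]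
    determines the avoider that it sorts. *)
Lemma run_partition_inj n : {in Av n mesh132_20 &, injective (@run_partition n)}.
Proof.
(* [lr_min s x] lies in the block of [x], which is the same for [t]; so [lr_min t] sends it to
   [lr_min t x]. *)
have le_min (s t : 'S_n) x :
    run_partition s = run_partition t -> lr_min t x <= lr_min s x.
  move/(preim_partition_inj (lr_min s x) x); rewrite lr_min_id eqxx.
  by move/esym/eqP <-; apply: lr_min_le.
move=> s t /Av132_sorts srt_s /Av132_sorts srt_t eq_st.
apply: sorts_inj srt_s (eq_sorts _ srt_t) => x.
by apply/val_inj/anti_leq; rewrite /= !le_min.
Qed.

(** The preimage is the permutation sorted by the block minima [r] of [P]; its prefix minima are [r]
    again. *)
Lemma run_partition_onto n (P : {set {set 'I_n}}) :
  partition P [set: 'I_n] ->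
  exists2 s, s \in Av n mesh132_20 & P = run_partition s.
Proof.
move=> partP; have [/eqP covP tiP _] := and3P partP.
have mem_pb x : x \in pblock P x by rewrite mem_pblock covP.
pose r x := [arg min_(y < x | y \in pblock P x) y].
have r_in x : r x \in pblock P x by rewrite /r; case: arg_minnP.
have r_min x y : y \in pblock P x -> r x <= y.
  by rewrite /r; case: arg_minnP => // z _; apply.
have pb_r x : pblock P (r x) = pblock P x by apply: same_pblock.
have r_eq x y : (r x == r y) = (pblock P x == pblock P y).
  apply/eqP/eqP => [eq_r | eq_pb]; first by rewrite -pb_r eq_r pb_r.
  by apply/val_inj/anti_leq; rewrite /= !r_min ?eq_pb // -eq_pb.
have r_le x : r x <= x by exact: r_min.
have r_id x : r (r x) = r x by apply/eqP; rewrite r_eq pb_r.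
have [s srt] := sorts_exist r.
exists s; first exact: sorts_Av132 r_le r_id srt.
rewrite -[LHS](preim_partition_pblock partP).
apply: eq_imset => x; apply/setP => y.
by rewrite !inE !(sorts_lr_min r_le r_id srt) r_eq.
Qed.

(** * The generating function *)

Local Open Scope ring_scope.

Theorem proposition3p3 (n : nat) (hn : (1 <= n)%N) :
  \sum_(s in Av n mesh132_20) 'X^(des s) =
  \sum_(0 <= k < n) (stirling2 n k.+1)%:R *: 'X^k :> {poly int}.
Proof.
case: n hn => // n _.
have card_runs (s : 'S_n.+1) : s \in Av n.+1 mesh132_20 ->
    #|run_partition s| = (des s).+1.
  by move=> avs; rewrite card_run_partition card_fix_lr_min.
have -> : \sum_(s in Av n.+1 mesh132_20) 'X^(des s) =
    \sum_(P | partition P [set: 'I_n.+1]) 'X^(#|P|.-1) :> {poly int}.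
  rewrite (eq_bigr (fun s => 'X^(#|run_partition s|.-1))); last first.
    by move=> s /card_runs->.
  rewrite -(big_imset (fun P : {set {set 'I_n.+1}} => 'X^(#|P|.-1)) (@run_partition_inj _)) /=.
  apply: eq_bigl => P; apply/imsetP/idP => [[s _ ->] | /run_partition_onto //].
  exact: preim_partitionP.
(* These bounds make the class index [inord #|P|.-1] below faithful: it is one less than the number
   of blocks. *)
have card_bounds (P : {set {set 'I_n.+1}}) : partition P [set: 'I_n.+1] -> (0 < #|P| <= n.+1)%N.
  case/run_partition_onto => s avs ->; rewrite (card_runs s avs) /=.
  rewrite -(card_runs s avs) card_run_partition.
  by apply: leq_trans (max_card _) _; rewrite card_ord.
(* Set partitions are grouped by [k], one less than their number of blocks; each class contributes
   [stirling2 n.+1 k.+1] equal terms. *)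
rewrite (partition_big (fun P : {set {set 'I_n.+1}} => inord #|P|.-1 : 'I_n.+1) xpredT) //= big_mkord.
apply: eq_bigr => k _.
rewrite scaler_nat -sumr_const.
apply: eq_big => [P | P /andP[/card_bounds bP /eqP <-]]; last first.
  by rewrite inordK //; case: #|P| bP.
rewrite inE; case: (boolP (partition P _)) => //= /card_bounds bP.
by rewrite -(inj_eq val_inj) /= inordK; case: #|P| bP.
Qed.
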